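(* Let $\rho$ be a calibration function and set $u_k=\lfloor\rho^{-1}(k)\rfloor$ for $k\in\mathbb{N}$. Let $1\le p<\infty$ and let $B_{\mathbf{w}}$ be a weighted backward shift on $\ell^p(\mathbb{N})$, with bounded weight sequence $\mathbf{w}=(w_n)_{n=1}^\infty$, for which $w_n\ge1$ for each $n$. Put $\alpha_n=\frac{1}{w_1w_2\cdots w_n}$ for $n\ge1$. Then $B_{\mathbf{w}}$ is $\rho$-frequently hypercyclic if and only if $$\sum_{j=1}^\infty\alpha_{u_j}^{\,p}<\infty.$$
   Context: $\mathbb{N}=\{1,2,3,\dots\}$. A calibration function is a function $\rho\colon[0,\infty)\to[0,\infty)$ such that: (1) $\rho$ is continuous, strictly increasing and unbounded; (2) $|\rho(t_1)-\rho(t_2)|\le|t_1-t_2|$ for all $t_1,t_2\ge0$; (3) $\rho$ is concave; (4) $\rho(t)/t$ is a non-increasing function of $t>0$; normalized so that $\rho(0)=0$. (Only the behaviour of $\rho$ for large $t$ matters, and functions having these properties only for large $t$ are regarded as calibration functions after modification for small $t$.) The lower $\rho$-density of $\mathcal{A}\subseteq\mathbb{N}$ is $\liminf_{N\to\infty}\frac{\#\{n\in\mathcal{A}: n\le N\}}{\rho(N)}\in[0,\infty]$. A continuous linear operator $T$ on a separable infinite-dimensional Fréchet space $X$ is $\rho$-frequently hypercyclic if there is $x\in X$ such that, for each nonempty open $U\subset X$, the return set $\{n\in\mathbb{N}: T^nx\in U\}$ has positive lower $\rho$-density. Elements of $\ell^p(\mathbb{N})$ are written $(x_0,x_1,x_2,\dots)$,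 with canonical basis $(e_n)_{n=0}^\infty$. For a bounded sequence $\mathbf{w}=(w_n)_{n=1}^\infty$ of positive reals, the weighted backward shift is $B_{\mathbf{w}}(x_0,x_1,x_2,\dots)=(w_1x_1,w_2x_2,w_3x_3,\dots)$. *)

(* Defs.v *)
From HB Require Import structures.
From mathcomp Require Import all_boot all_order all_algebra.
From mathcomp Require Import complex.
From mathcomp Require Import all_classical all_reals all_analysis.

Set Implicit Arguments.
Unset Strict Implicit.
Unset Printing Implicit Defensive.
Import Order.TTheory GRing.Theory Num.Theory.
Import numFieldNormedType.Exports.
Local Open Scope classical_set_scope.
Local Open Scope ring_scope.

(* [rho] is a map [0, +oo[ -> [0, +oo[; its values at negative reals are
   irrelevant. *)
Record calibration (R : realType) (rho : R -> R) : Prop := Calibration {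
  calibration_ge0 : forall t, 0 <= t -> 0 <= rho t;
  calibration_continuous : {within `[0, +oo[, continuous rho};
  calibration_increasing : forall s t, 0 <= s -> s < t -> rho s < rho t;
  calibration_unbounded : forall M, exists2 t, 0 <= t & M < rho t;
  calibration_lipschitz : forall s t, 0 <= s -> 0 <= t ->
    `|rho s - rho t| <= `|s - t|;
  calibration_concave : forall s t a, 0 <= s -> 0 <= t -> 0 <= a -> a <= 1 ->
    a * rho s + (1 - a) * rho t <= rho (a * s + (1 - a) * t);
  calibration_ratio : forall s t, 0 < s -> s <= t -> rho t / t <= rho s / s;
  calibration0 : rho 0 = 0 }.

Definition calibration_inv (R : realType) (rho : R -> R) : R -> R :=
  'pinv_(fun=> 0) `[0, +oo[ rho.

(* [Num.truncn] is the integer part, as a natural number, of a nonnegative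
   real. *)
Definition calibration_seq (R : realType) (rho : R -> R) (k : nat) : nat :=
  Num.truncn (calibration_inv rho k%:R).

(* The term of index N = 0 (where rho 0 = 0) does not affect the lower limit. *)
Definition lower_density (R : realType) (rho : R -> R) (A : set nat) : \bar R :=
  limn_einf
    (fun N => ((\sum_(1 <= n < N.+1) \1_A n) / rho N%:R)%:E : \bar R).

Definition return_set (X : Type) (T : X -> X) (x : X) (U : set X) : set nat :=
  [set n | (0 < n)%N /\ U (iter n T x)].

(* Meant for separable infinite-dimensional Frechet spaces, i.e. for a class of
   locally convex topological vector spaces containing the l^p below; only the
   topology and the linear structure occur in the notion itself. *)
Definition frequently_hypercyclic (R : realType) (rho : R -> R)
    (K : numFieldType) (X : tvsType K) (T : {linear X -> X}) : Prop :=
  continuous T /\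
  exists x : X, forall U : set X, open U -> U !=set0 ->
    (0 < lower_density rho (return_set T x U))%E.

Variant scalar_kind := RealScalars | ComplexScalars.

Definition scalar (R : realType) (s : scalar_kind) : numFieldType :=
  match s with RealScalars => R | ComplexScalars => R[i] end.

Definition modulus (R : realType) (s : scalar_kind) : scalar R s -> R :=
  match s with
  | RealScalars => fun x : R => `|x|
  | ComplexScalars => fun z : R[i] => ComplexField.Normc.normc z
  end.

Definition of_real (R : realType) (s : scalar_kind) : R -> scalar R s :=
  match s with
  | RealScalars => fun r : R => r
  | ComplexScalars => fun r : R => r%:C%C
  end.
Arguments of_real {R} s r.

Section scalar_theory.
Context {R : realType} {s : scalar_kind}.
Implicit Types (x y : scalar R s) (a b : R).

Lemma modulusE x : of_real s (modulus x) = `|x|.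
Proof. by case: s x => //= -[u v]; rewrite normc_def. Qed.

Lemma modulus_ge0 x : 0 <= modulus x.
Proof.
case: s x => [x|[u v]] /=; first exact: normr_ge0.
exact: sqrtr_ge0.
Qed.

Lemma modulusM x y : modulus (x * y) = modulus x * modulus y.
Proof.
case: s x y => [x y|x y] /=; first exact: normrM.
exact: ComplexField.Normc.normcM.
Qed.

Lemma modulusD x y : modulus (x + y) <= modulus x + modulus y.
Proof.
case: s x y => [x y|x y] /=; first exact: ler_normD.
exact: le_normcD.
Qed.

Lemma modulus0 : modulus (0 : scalar R s) = 0.
Proof.
case: s => /=; first exact: normr0.
exact: ComplexField.Normc.normc0.
Qed.

Lemma modulus_eq0 x : modulus x = 0 -> x = 0.
Proof.
case: s x => [x /normr0P/eqP //|x] /=.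
exact: ComplexField.Normc.eq0_normc.
Qed.

Lemma modulus_of_real a : modulus (of_real s a) = `|a|.
Proof. by case: s => //=; rewrite expr0n addr0 sqrtr_sqr. Qed.

Lemma of_realD a b : of_real s (a + b) = of_real s a + of_real s b.
Proof. by case: s => //=; rewrite rmorphD. Qed.

Lemma of_realM a b : of_real s (a * b) = of_real s a * of_real s b.
Proof. by case: s => //=; rewrite rmorphM. Qed.

Lemma of_real_le a b : (of_real s a <= of_real s b) = (a <= b).
Proof. by case: s => //=; rewrite lecR. Qed.

Lemma of_real_inj : injective (of_real s : R -> _).
Proof. by case: s => //= a b []. Qed.

Lemma of_real0 : of_real s (0 : R) = 0.
Proof. by case: s. Qed.

End scalar_theory.

Section lnorm_theory.
Context {R : realType} {p : R} (p1 : 1 <= p).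
Implicit Types f g : nat -> R.
Local Notation N f := ('N[counting]_p%:E[EFin \o f])%E.

Let p0 : 0 < p. Proof. exact: lt_le_trans ltr01 p1. Qed.

Lemma lnormE f :
  N f = ((\sum_(k <oo) (`|f k| `^ p)%:E) `^ p^-1)%E.
Proof. by rewrite Lnorm_counting. Qed.

Lemma lnorm_le f g : (forall k, `|f k| <= `|g k|) -> (N f <= N g)%E.
Proof.
move=> fg; rewrite !lnormE; apply: gt0_ler_poweR.
- by rewrite invr_ge0 ltW.
- by rewrite in_itv/= leey andbT; apply: nneseries_ge0 => k _ _; rewrite lee_fin powR_ge0.
- by rewrite in_itv/= leey andbT; apply: nneseries_ge0 => k _ _; rewrite lee_fin powR_ge0.
apply: lee_nneseries => k _; first by rewrite lee_fin powR_ge0.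
by rewrite lee_fin ge0_ler_powR// ltW.
Qed.

Lemma lnormD f g : (N (f \+ g)%R <= N f + N g)%E.
Proof. exact: minkowski_EFin. Qed.

Lemma lnormZ (a : R) f : N (fun k => a * f k)%R = (`|a|%:E * N f)%E.
Proof.
rewrite !lnormE.
under eq_eseriesr do rewrite normrM powRM// EFinM.
rewrite nneseriesZl; last by move=> k _; rewrite lee_fin powR_ge0.
rewrite poweRM.
- by rewrite poweR_EFin -powRrM mulfV ?gt_eqF// powRr1.
- by rewrite lee_fin powR_ge0.
- by apply: nneseries_ge0 => k _ _; rewrite lee_fin powR_ge0.
Qed.

Lemma lnorm_shift f : (N (fun k => f k.+1) <= N f)%E.
Proof.
rewrite !lnormE; apply: gt0_ler_poweR.
- by rewrite invr_ge0 ltW.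
- by rewrite in_itv/= leey andbT; apply: nneseries_ge0 => k _ _; rewrite lee_fin powR_ge0.
- by rewrite in_itv/= leey andbT; apply: nneseries_ge0 => k _ _; rewrite lee_fin powR_ge0.
have h0 k : (0 <= (`|f k| `^ p)%:E)%E by rewrite lee_fin powR_ge0.
rewrite (nneseries_recl (P := xpredT) (f := fun k => (`|f k| `^ p)%:E))//.
rewrite -(nneseries_addn 1 h0).
under [leLHS]eq_eseriesr => k _ do rewrite -addn1.
by rewrite leeDr.
Qed.

End lnorm_theory.

Section lp.
Context (R : realType) (s : scalar_kind) (p : R).
Local Notation K := (scalar R s).
Implicit Types x y : nat -> K.

(* the p-norm of a sequence, as an L^p-norm for the counting measure on nat *)
Definition lp_enorm x : \bar R :=
  ('N[counting]_p%:E[EFin \o (fun k => modulus (x k))])%E.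

Definition lp_seq : {pred nat -> K} := [pred x | (lp_enorm x < +oo)%E].

Hypothesis p1 : 1 <= p.

Lemma lp_enormD x y : (lp_enorm (x + y)%R <= lp_enorm x + lp_enorm y)%E.
Proof.
apply: (le_trans _ (lnormD p1 (fun k => modulus (x k)) (fun k => modulus (y k)))).
apply: (lnorm_le p1 (f := fun k => modulus (x k + y k)%R)) => k /=.
by rewrite !ger0_norm ?addr_ge0 ?modulus_ge0// modulusD.
Qed.

Lemma lp_enormZ (a : K) x : lp_enorm (a *: x)%R = ((modulus a)%:E * lp_enorm x)%E.
Proof.
rewrite -[modulus a]ger0_norm ?modulus_ge0//.
rewrite -(lnormZ p1 _ (fun k => modulus (x k))).
by congr Lnorm; apply/funext => k /=; rewrite modulusM.
Qed.

Lemma lp_enorm0 : lp_enorm 0 = 0%E.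
Proof.
have -> : (0 : nat -> K) = 0 *: 0 by rewrite scale0r.
by rewrite lp_enormZ modulus0 mul0e.
Qed.

Lemma lp_seq_submod_closed : submod_closed lp_seq.
Proof.
split=> [|a x y]; rewrite !inE; first by rewrite lp_enorm0.
move=> xp yp; apply: le_lt_trans (lp_enormD _ _) _.
rewrite lp_enormZ lte_add_pinfty// lte_mul_pinfty// lee_fin.
exact: modulus_ge0.
Qed.

(* The phantom argument lets the instances below, which need 1 <= p, be
   inferred. *)
Record lp_space (p_ge1 : 1 <= p) : Type :=
  Lp { lp_val :> nat -> K; lp_valP : lp_val \in lp_seq }.
Local Notation lp := (lp_space p1).

HB.instance Definition _ := [isSub of lp for @lp_val p1].
HB.instance Definition _ := gen_eqMixin lp.
HB.instance Definition _ := gen_choiceMixin lp.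
HB.instance Definition _ := GRing.isSubmodClosed.Build _ _ lp_seq
  lp_seq_submod_closed.
HB.instance Definition _ := [SubChoice_isSubLmodule of lp by <:].

Implicit Types u v : lp.

Lemma lp_valD u v k : (u + v : lp) k = u k + v k. Proof. by []. Qed.

Lemma lp_valZ a u k : (a *: u : lp) k = a * u k. Proof. by []. Qed.

Definition lp_norm u : R := fine (lp_enorm u).

Lemma lp_normE u : (lp_norm u)%:E = lp_enorm u.
Proof.
rewrite fineK// ge0_fin_numE ?Lnorm_ge0//.
by have := lp_valP u; rewrite inE.
Qed.

Lemma lp_norm_ge0 u : 0 <= lp_norm u.
Proof. by rewrite -lee_fin lp_normE Lnorm_ge0. Qed.

Lemma lp_normD u v : lp_norm (u + v) <= lp_norm u + lp_norm v.
Proof. by rewrite -lee_fin EFinD !lp_normE lp_enormD. Qed.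

Lemma lp_normZ a u : lp_norm (a *: u) = modulus a * lp_norm u.
Proof. by apply: EFin_inj; rewrite EFinM !lp_normE -lp_enormZ. Qed.

Lemma lp_norm_eq0 u : lp_norm u = 0 -> u = 0.
Proof.
move=> nu0; have := lp_normE u; rewrite nu0 /lp_enorm => /esym.
rewrite (lnormE p1 (fun k => modulus (u k))) => u0.
apply/val_inj/funext => k /=; apply: modulus_eq0; apply/eqP.
have {}u0 : (\sum_(k <oo) (`|modulus (u k)| `^ p)%:E = 0)%E.
  apply: poweR_eq0_eq0 u0.
  by apply: nneseries_ge0 => i _ _; rewrite lee_fin powR_ge0.
have h0 i : (0 <= (`|modulus (u i)| `^ p)%:E)%E by rewrite lee_fin powR_ge0.
have : ((`|modulus (u k)| `^ p)%:E <= 0)%E.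
  rewrite -u0; apply: le_trans (nneseries_lim_ge k.+1 (fun i _ _ => h0 i)).
  by rewrite big_nat_recr//= leeDr// sume_ge0.
rewrite lee_fin => hle; rewrite -normr_eq0; apply/eqP/(@powR_eq0_eq0 _ _ p).
by apply/eqP; rewrite eq_le hle powR_ge0.
Qed.

Let lp_normK_D u v :
  of_real s (lp_norm (u + v)) <= of_real s (lp_norm u) + of_real s (lp_norm v).
Proof. by rewrite -of_realD of_real_le lp_normD. Qed.

Let lp_normK_Z a u :
  of_real s (lp_norm (a *: u)) = `|a| * of_real s (lp_norm u).
Proof. by rewrite lp_normZ of_realM modulusE. Qed.

Let lp_normK_eq0 u : of_real s (lp_norm u) = 0 -> u = 0.
Proof. by rewrite -of_real0 => /of_real_inj/lp_norm_eq0. Qed.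

HB.instance Definition _ :=
  Lmodule_isNormed.Build K lp lp_normK_D lp_normK_Z lp_normK_eq0.

Lemma lp_normrE u : `|u| = of_real s (lp_norm u).
Proof. by []. Qed.

End lp.

(* The weights are indexed by n >= 1; [wt 0] is irrelevant. *)
Record weights (R : realType) : Type := Weights {
  wt :> nat -> R;
  wt_gt0 : forall n, (0 < n)%N -> 0 < wt n;
  wt_bounded : exists M, forall n, (0 < n)%N -> wt n <= M }.

Definition alpha (R : realType) (w : nat -> R) (n : nat) : R :=
  (\prod_(1 <= i < n.+1) w i)^-1.

Section weighted_backward_shift.
Context (R : realType) (s : scalar_kind) (p : R) (p1 : 1 <= p) (w : weights R).
Local Notation K := (scalar R s).
Local Notation lp := (lp_space s p1).

Definition bshift_fun (x : nat -> K) : nat -> K :=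
  fun n => of_real s (w n.+1) * x n.+1.

Lemma lp_enorm_bshift (M : R) (x : nat -> K) :
  (forall n, (0 < n)%N -> w n <= M) ->
  (lp_enorm p (bshift_fun x) <= M%:E * lp_enorm p x)%E.
Proof.
move=> wM.
have M0 : 0 <= M by apply: le_trans (wM 1%N _) => //; exact/ltW/wt_gt0.
rewrite -[M]ger0_norm//.
rewrite -(lnormZ p1 M (fun k => modulus (x k))).
apply: le_trans (lnorm_shift p1 (fun k => M * modulus (x k))).
apply: (lnorm_le p1 (f := fun k => modulus (bshift_fun x k))) => k /=.
rewrite modulusM modulus_of_real !normrM normr_id.
by rewrite ler_wpM2r// (ger0_norm M0) ger0_norm ?wM// ltW// wt_gt0.
Qed.

Lemma bshift_subproof (x : lp) : bshift_fun x \in lp_seq p.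
Proof.
have [M wM] := wt_bounded w.
rewrite inE; apply: le_lt_trans (lp_enorm_bshift x wM) _.
by rewrite -(lp_normE x) -EFinM ltry.
Qed.

Definition bshift (x : lp) : lp := Lp p1 (bshift_subproof x).

Lemma bshift_is_linear : linear bshift.
Proof.
move=> a x y; apply/val_inj/funext => n.
rewrite -[LHS]/(of_real s (w n.+1) * (a * x n.+1 + y n.+1)).
by rewrite mulrDr mulrCA.
Qed.

HB.instance Definition _ := GRing.isLinear.Build K lp lp _ bshift
  bshift_is_linear.

Lemma bshift_continuous : continuous bshift.
Proof.
have [M wM] := wt_bounded w.
have M0 : 0 < M by apply: lt_le_trans (wM 1%N _) => //; exact/wt_gt0.
apply: bounded_linear_continuous; apply/linear_boundedP.
exists (of_real s M); split.
  by apply: ger0_real; rewrite -of_real0 of_real_le ltW.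
move=> r Mr x; apply: (@le_trans _ _ (of_real s M * `|x|)); last first.
  by rewrite ler_wpM2r// ltW.
rewrite !lp_normrE -of_realM of_real_le -lee_fin EFinM !lp_normE.
exact: lp_enorm_bshift.
Qed.

End weighted_backward_shift.

Arguments lp_space {R} s {p} p_ge1.
Arguments bshift {R} s {p} p1 w x.

(* Main.v *)
Require Import Defs.
From mathcomp Require Import all_boot all_order all_algebra.
From mathcomp Require Import all_classical all_reals all_analysis.
From mathcomp Require Import complex ring lra zify.

(** Write rho^-1 for the inverse of rho and u_k for the integer part of
    rho^-1(k). Since rho(t)/t is non-increasing, rho is subadditive, so u is
    superadditive: u_i + u_j <= u_(i+j). The set of all u_k has rho-density
    1 and is thus the model of a set of positive lower rho-density.

    Necessity. If x is rho-frequently hypercyclic, the set A of times at which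
    the orbit is within 1/2 of the first basis vector has positive lower
    rho-density, and alpha_n <= 2 |x_n| for n in A; so the alpha_n^p are
    summable over A. As alpha is non-increasing and the counting function of A
    eventually dominates a multiple of that of {u_k}, summation by parts
    transfers the summability from A to {u_k} ([sum_calibration_seq_le]).

    Sufficiency. Put a_i = alpha_(u_i)^p. A summable positive sequence can be
    multiplied by some non-decreasing unbounded c and stay summable, with the
    tail from r of c_i a_i at most 2 / c_r ([summable_amplification]). Let nu
    be the 2-adic valuation and n_j = j + nu(j!) + nu((j-1)!). Then
    n_k - n_j > nu(j) + nu(k) for j < k, while n_j <= 3 j. The vector x is the
    sum over j >= 1 of the translates to time u_(n_j) of a finitely supported
    rational vector y_j that depends on r = nu(j) only: translation by n
    multiplies the coordinate i by alpha_(n+i) / alpha_i, so that n steps of the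
    shift undo it. The vectors are allotted to the classes r so slowly that the
    one of class r has length at most r and cost at most c_r, where the cost is
    the sum of (|y(i)| / alpha_i)^p; yet each rational vector comes back for
    arbitrarily large r ([target_recurs]). The gaps make the translates
    disjoint, so p-th powers of norms add up. At time u_(n_j) the earlier
    translates have been shifted out, y_j itself is visible, and the later ones
    contribute at most, by superadditivity of u,
      sum over k > j of c_(nu(k)) alpha_(u_(n_k) - u_(n_j))^p
        <= sum over k > j of (c a)_(n_k - n_j) <= sum over i > nu(j) of (c a)_i
        <= 2 / c_(nu(j)),
    which is small when the class is large ([remainder_sum]). The j of a given
    class form an arithmetic progression and n_j <= 3 j, so each class of times
    has positive lower rho-density ([lower_density_subsequence_gt0]). *)

Set Implicit Arguments.
Unset Strict Implicit.
Unset Printing Implicit Defensive.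
Import Order.TTheory GRing.Theory Num.Theory.
Import numFieldNormedType.Exports.
Local Open Scope classical_set_scope.
Local Open Scope ring_scope.

(** * Sums of real sequences *)

Lemma lty_nneseriesP (R : realType) (f : nat -> R) (m : nat) :
  (forall n, 0 <= f n) ->
  (\sum_(m <= n <oo) (f n)%:E < +oo)%E <->
  exists B, forall N, \sum_(m <= n < N) f n <= B.
Proof.
move=> f0; have fE0 n : (m <= n)%N -> true -> (0 <= (f n)%:E)%E.
  by rewrite lee_fin.
split=> [fy|[B fB]].
- exists (fine (\sum_(m <= n <oo) (f n)%:E)) => N.
  rewrite -lee_fin fineK; last first.
    by rewrite ge0_fin_numE//; apply: nneseries_ge0 => n _ _; rewrite lee_fin.
  by rewrite -sumEFin; apply: nneseries_lim_ge.
- apply: (@le_lt_trans _ _ B%:E); last exact: ltry.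
  apply: lime_le; first exact: is_cvg_nneseries.
  by apply: nearW => N; rewrite sumEFin lee_fin.
Qed.

(** By Abel summation the sum of [d n * g n] is a combination of the partial sums
    of [d] whose coefficients, the decrements of [g] and its last value, are
    nonnegative and have total [g 0]; this compares sums of [g] over two sets through their
    counting functions. *)
Lemma summation_by_parts_ge (R : realType) (g d : nat -> R) (C : R) :
  (forall n, 0 <= g n) -> (forall n, g n.+1 <= g n) ->
  (forall N, - C <= \sum_(0 <= n < N) d n) ->
  forall N, - (C * g 0%N) <= \sum_(0 <= n < N) d n * g n.
Proof.
move=> g0 gd dC N.
have C0 : 0 <= C by move: (dC 0%N); rewrite big_nil oppr_le0.
(* The boundary term is kept so that the induction goes through. *)
have key : (\sum_(0 <= n < N) d n) * g N - C * (g 0%N - g N)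
    <= \sum_(0 <= n < N) d n * g n.
  elim: N => [|N IH]; first by rewrite !big_nil; lra.
  rewrite !big_nat_recr//=.
  move: IH; set D := \sum_(_ <= _ < _) d _; set S := \sum_(_ <= _ < _) _.
  move=> IH.
  have DC : 0 <= D + d N + C.
    by move: (dC N.+1); rewrite big_nat_recr//= -/D; lra.
  have gN : 0 <= g N - g N.+1 by rewrite subr_ge0.
  move: (mulr_ge0 DC gN).
  by move: IH; lra.
apply: le_trans key; have DC : 0 <= \sum_(0 <= n < N) d n + C.
  by move: (dC N); lra.
by move: (mulr_ge0 DC (g0 N)); lra.
Qed.

Lemma sum_indic_le (R : realType) (y : R) (M : nat) :
  0 <= y -> \sum_(1 <= j < M.+1) (j%:R <= y)%R%:R <= y.
Proof.
move=> y0; elim: M => [|M IH]; first by rewrite big_nil.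
case: (leP M.+1%:R y) => My.
- apply: le_trans My; apply: (@le_trans _ _ (\sum_(1 <= j < M.+2) 1)).
  + by apply: ler_sum => j _; rewrite lern1 leq_b1.
  + by rewrite big_const_nat iter_addr_0 subn1.
- by rewrite big_nat_recr//= (lt_geF My) addr0.
Qed.

Lemma sum_indicator_eq (R : realType) (g : nat -> R) (m N : nat) :
  (m < N)%N -> \sum_(0 <= n < N) (m == n)%:R * g n = g m.
Proof.
move=> mN; rewrite (big_nat_widenl 0 0)//= big_mkord.
rewrite (bigD1 (Ordinal mN))//= eqxx mul1r big1 ?addr0// => i im.
rewrite (_ : (m == i) = false) ?mul0r//.
by apply/eqP => mi; move/eqP: im; apply; apply/val_inj.
Qed.

Lemma sum_increasing_le (R : realType) (b : nat -> R) (n : nat -> nat)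
    (r j L : nat) :
  (forall i, 0 <= b i) ->
  (forall k l, (k < l)%N -> (n k < n l)%N) ->
  (forall k, (j < k)%N -> (r <= n k - n j)%N) ->
  \sum_(j.+1 <= k < L) b (n k - n j)%N <= \sum_(r <= i < n L - n j) b i.
Proof.
move=> b0 ninc nr; have S0 k l : 0 <= \sum_(k <= i < l) b i by apply: sumr_ge0.
elim: L => [|L IH]; first by rewrite big_geq.
have [Lj|jL] := leqP L j; first by rewrite big_geq.
have nLj := leq_sub2r (n j) (ltnW (ninc _ _ (ltnSn L))).
rewrite big_nat_recr//= (big_cat_nat (nr _ jL) nLj)/=.
apply: lerD => //.
rewrite big_ltn; last by have := ninc _ _ (ltnSn L); have := ninc _ _ jL; lia.
by rewrite lerDl.
Qed.

(** Take [c n = t_n ^ (-1/2)] where [t_n] is the tail of the series from [n]: then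
    [c n * a n = (t_n - t_(n+1)) / t_n ^ (1/2)] is at most
    [2 * (t_n ^ (1/2) - t_(n+1) ^ (1/2))], which telescopes, and [2 / c r] is
    [2 * t_r ^ (1/2)]. Positivity of [a] keeps the tails nonzero. *)
Lemma summable_amplification (R : realType) (a : nat -> R) (B : R) :
  (forall n, 0 < a n) -> (forall N, \sum_(0 <= n < N) a n <= B) ->
  exists c : nat -> R,
    [/\ forall n, 0 < c n,
        forall m n, (m <= n)%N -> c m <= c n,
        forall M, exists n, M <= c n &
        forall r N, \sum_(r <= n < N) c n * a n <= 2 / c r].
Proof.
move=> a0 aB; pose S N := \sum_(0 <= n < N) a n.
have SS N : S N.+1 = S N + a N by rewrite /S big_nat_recr.
have Smono m n : (m <= n)%N -> S m <= S n.
  elim: n => [|n IH]; first by rewrite leqn0 => /eqP->.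
  rewrite leq_eqVlt => /predU1P[->//|/IH h].
  by rewrite SS (le_trans h)// lerDl ltW.
have supS : has_sup (range S).
  by split; [exists (S 0%N), 0%N|exists B => _ [n _ <-]; exact: aB].
pose t n := sup (range S) - S n.
have t0 n : 0 < t n.
  rewrite subr_gt0; apply: (@lt_le_trans _ _ (S n.+1)).
    by rewrite SS ltrDl.
  by apply: sup_upper_bound => //; exists n.+1.
have tS n : t n = t n.+1 + a n by rewrite /t SS; lra.
pose q n := Num.sqrt (t n).
have q0 n : 0 < q n by rewrite sqrtr_gt0.
have qq n : q n * q n = t n by rewrite -expr2 sqr_sqrtr// ltW.
exists (fun n => (q n)^-1); split => [n|m n mn|M|r N].
- by rewrite invr_gt0.
- by rewrite lef_pV2 ?posrE// (ler_sqrt _ (ltW (t0 m))) lerD2l lerN2 Smono.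
- have M1 : 0 < 1 + `|M| by apply: ltr_pwDl.
  have e0 : 0 < (1 + `|M|)^-1 ^+ 2 by rewrite exprn_gt0// invr_gt0.
  have [_ [n _ <-] Sn] := sup_adherent e0 supS; exists n.
  apply: (@le_trans _ _ (1 + `|M|)).
    by rewrite (le_trans (ler_norm _))// lerDr.
  rewrite -[1 + _]invrK lef_pV2 ?posrE ?invr_gt0//.
  rewrite -(@ler_pXn2r _ 2) ?nnegrE ?invr_ge0 ?(ltW (q0 n)) ?(ltW M1)//.
  by rewrite [leLHS]expr2 qq /t lerBlDr addrC -lerBlDr ltW.
- rewrite invrK; have [rN|Nr] := leqP r N; last first.
    by rewrite big_geq ?(ltnW Nr)// mulr_ge0// ltW.
  apply: (@le_trans _ _ (2 * (q r - q N))); last by have := q0 N; lra.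
  elim: N rN => [|N IH].
    by rewrite leqn0 => /eqP->; rewrite big_geq// subrr mulr0.
  rewrite leq_eqVlt => /predU1P[->|]; first by rewrite big_geq// subrr mulr0.
  rewrite ltnS => rN; rewrite big_nat_recr//=.
  apply: (@le_trans _ _ (2 * (q r - q N) + 2 * (q N - q N.+1))); last by lra.
  apply: lerD; first exact: IH.
  rewrite mulrC ler_pdivrMr//.
  have := tS N; rewrite -!qq => h.
  by have := sqr_ge0 (q N - q N.+1); rewrite expr2; nra.
Qed.

Lemma summable_tail (R : realType) (a : nat -> R) (B e : R) :
  (forall n, 0 <= a n) -> (forall N, \sum_(0 <= n < N) a n <= B) -> 0 < e ->
  exists L, forall N, \sum_(L <= n < N) a n <= e.
Proof.
move=> a0 aB e0; pose S N := \sum_(0 <= n < N) a n.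
have supS : has_sup (range S).
  by split; [exists (S 0%N), 0%N|exists B => _ [n _ <-]; exact: aB].
have [_ [L _ <-] SL] := sup_adherent e0 supS; exists L => N.
have [NL|/ltnW LN] := leqP N L; first by rewrite big_geq// ltW.
have : S N <= sup (range S) by apply: sup_upper_bound => //; exists N.
by move: SL; rewrite /S (big_cat_nat (leq0n L) LN)/=; lra.
Qed.

Lemma sum_le_support (R : realType) (h : nat -> R) (L N : nat) :
  (forall n, 0 <= h n) -> (forall n, (L <= n)%N -> h n = 0) ->
  \sum_(0 <= n < N) h n <= \sum_(0 <= n < L) h n.
Proof.
move=> h0 hL; have [NL|/ltnW LN] := leqP N L.
  by rewrite [leRHS](big_cat_nat (leq0n N) NL)/= lerDl sumr_ge0.
rewrite (big_cat_nat (leq0n L) LN)/= gerDl big_nat_cond big1// => n.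
by rewrite andbT => /andP[Ln _]; exact: hL.
Qed.

(** * Calibration functions and their inverse sequence *)

Section Calibration.
Context (R : realType) (rho : R -> R) (hrho : calibration rho).
Local Notation v := (fun k : nat => calibration_inv rho k%:R).
Local Notation u := (calibration_seq rho).

Lemma calibration_le s t : 0 <= s -> s <= t -> rho s <= rho t.
Proof.
move=> s0; rewrite le_eqVlt => /predU1P[->//|st].
exact/ltW/(calibration_increasing hrho).
Qed.

Lemma calibration_le_id t : 0 <= t -> rho t <= t.
Proof.
move=> t0; have := calibration_lipschitz hrho t0 (lexx 0).
by rewrite (calibration0 hrho) !subr0 !ger0_norm// (calibration_ge0 hrho).
Qed.

(** With [x = s] and [x = t], [rho x] is at least [x] times the slope
    [rho (s + t) / (s + t)]. *)
Lemma calibration_subadditive s t :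
  0 <= s -> 0 <= t -> rho (s + t) <= rho s + rho t.
Proof.
rewrite le_eqVlt => /predU1P[<-|s0].
  by rewrite (calibration0 hrho) !add0r.
rewrite le_eqVlt => /predU1P[<-|t0].
  by rewrite (calibration0 hrho) !addr0.
have st0 : 0 < s + t by rewrite addr_gt0.
have ratio x : 0 < x -> x <= s + t -> x * (rho (s + t) / (s + t)) <= rho x.
  move=> x0 xst; have := calibration_ratio hrho x0 xst.
  by rewrite ler_pdivlMr// mulrC.
have := lerD (ratio s s0 _) (ratio t t0 _).
rewrite lerDl lerDr -mulrDl mulrC divfK ?gt_eqF//.
by apply; exact/ltW.
Qed.

Lemma calibration_invP k : 0 <= v k /\ rho (v k) = k%:R.
Proof.
have [T T0 kT] := calibration_unbounded hrho k%:R.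
have [||c] := @IVT _ rho 0 T k%:R T0.
- apply: continuous_subspaceW (calibration_continuous hrho).
  by move=> x /=; rewrite !in_itv/= => /andP[->].
- by rewrite (calibration0 hrho) ge_min le_max ler0n (ltW kT) orbT.
rewrite in_itv/= => /andP[c0 _] rc.
have rinj : {in `[0, +oo[%classic &, injective rho}.
  move=> x y /set_mem; rewrite /= in_itv/= andbT => x0.
  move=> /set_mem; rewrite /= in_itv/= andbT => y0 rxy.
  case: (ltgtP x y) => // [xy|yx].
  - by have := calibration_increasing hrho x0 xy; rewrite rxy ltxx.
  - by have := calibration_increasing hrho y0 yx; rewrite rxy ltxx.
suff -> : v k = c by [].
rewrite /calibration_inv -rc pinvKV// inE/= in_itv/= andbT//.
Qed.

Lemma calibration_seqP k : (u k)%:R <= v k < (u k).+1%:R.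
Proof. by have [v0 _] := calibration_invP k; rewrite truncn_itv. Qed.

Lemma calibration_inv_le k t : 0 <= t -> k%:R <= rho t -> v k <= t.
Proof.
move=> t0 kt; have [v0 rv] := calibration_invP k; rewrite leNgt; apply/negP => tv.
by have := calibration_increasing hrho t0 tv; rewrite rv ltNge kt.
Qed.

Lemma calibration_seq_le k n : k%:R <= rho n%:R -> (u k <= n)%N.
Proof.
move=> kn; have /andP[uv _] := calibration_seqP k.
by rewrite -(ler_nat R) (le_trans uv)// calibration_inv_le.
Qed.

(** The error 1 comes from the integer part in [u k], since [rho] is
    1-Lipschitz. *)
Lemma le_calibration_seq k n : (u k <= n)%N -> k%:R <= rho n%:R + 1.
Proof.
move=> ukn; have [v0 <-] := calibration_invP k.
have /andP[_ vu] := calibration_seqP k.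
apply: (@le_trans _ _ (rho (n%:R + 1))).
  apply: calibration_le => //; apply: (le_trans (ltW vu)).
  by rewrite natr1 ler_nat ltnS.
apply: (le_trans (calibration_subadditive _ _)) => //.
by rewrite lerD2l calibration_le_id.
Qed.

Lemma calibration_seq_ge k : (k <= u k)%N.
Proof.
have [v0 rv] := calibration_invP k.
by rewrite truncn_ge_nat// -[leLHS]rv calibration_le_id.
Qed.

(** Subadditivity of [rho] is superadditivity of its inverse, and taking integer
    parts preserves it. *)
Lemma calibration_seq_superadditive i j : (u i + u j <= u (i + j))%N.
Proof.
have [vi0 ri] := calibration_invP i; have [vj0 rj] := calibration_invP j.
have [vij0 rij] := calibration_invP (i + j).
have /andP[ui _] := calibration_seqP i; have /andP[uj _] := calibration_seqP j.
rewrite truncn_ge_nat// natrD; apply: (le_trans (lerD ui uj)).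
rewrite leNgt; apply/negP => /(calibration_increasing hrho vij0).
apply/negP; rewrite -leNgt rij natrD -{2}ri -{2}rj.
exact: calibration_subadditive.
Qed.

Lemma calibration_seq0 : u 0 = 0%N.
Proof. by have := calibration_seq_superadditive 0 0; rewrite addn0; lia. Qed.

Lemma calibration_seq_sub i j : (i <= j)%N -> (u (j - i) <= u j - u i)%N.
Proof.
move=> ij; have := calibration_seq_superadditive i (j - i).
by rewrite subnKC//; lia.
Qed.

Lemma calibration_seq_mono i j : (i <= j)%N -> (u i <= u j)%N.
Proof.
move=> ij; have := calibration_seq_superadditive i (j - i).
by rewrite subnKC//; lia.
Qed.

Lemma calibration_cvgy M : exists N, forall n, (N <= n)%N -> M <= rho n%:R.
Proof.
have [t t0 Mt] := calibration_unbounded hrho M.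
exists (Num.truncn t).+1 => n tn; apply: (le_trans (ltW Mt)).
apply: calibration_le => //; have /andP[_ tt] := truncn_itv t0.
by rewrite (le_trans (ltW tt))// ler_nat.
Qed.

Lemma lower_density_gt0P (A : set nat) :
  (0 < lower_density rho A)%E <->
  exists c : R, 0 < c /\ exists N0, forall N, (N0 <= N)%N ->
    c * rho N%:R <= \sum_(1 <= n < N.+1) \1_A n.
Proof.
pose d N := \sum_(1 <= n < N.+1) (\1_A n : R).
have rhogt0 N : (0 < N)%N -> 0 < rho N%:R.
  move=> N0; rewrite -(calibration0 hrho).
  by apply: (calibration_increasing hrho) => //; rewrite ltr0n.
rewrite /lower_density limn_einf_lim.
set e := einfs _.
have -> : limn e = ereal_sup (range e) by apply/cvg_lim => //; exact: cvg_einfs_sup.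
split=> [|[c [c0 [N0 cN]]]].
- move=> /ereal_sup_gt[_ [n0 _ <-] en0].
  have [c c0 ce] : exists2 c : R, 0 < c & (c%:E <= e n0)%E.
    move: en0; case: (e n0) => [x x0|_|//]; first by exists x.
    by exists 1; rewrite ?ltr01// leey.
  exists c; split=> //; exists n0.+1 => N n0N.
  rewrite -ler_pdivlMr ?rhogt0//; last exact: leq_ltn_trans n0N.
  rewrite -lee_fin (le_trans ce)//; apply: ereal_inf_lbound; exists N => //=.
  exact: ltnW.
- apply: (@lt_le_trans _ _ c%:E); first by rewrite lte_fin.
  apply: (@le_trans _ _ (e (maxn N0 1))); last first.
    by apply: ereal_sup_ubound; exists (maxn N0 1).
  apply: le_ereal_inf_tmp => _ [N /= N0N <-].
  rewrite lee_fin ler_pdivlMr ?cN ?rhogt0//;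
    by move: N0N; rewrite geq_max => /andP[].
Qed.

End Calibration.

(** * Weights, iterates of the shift, and p-norms *)

Section Weights.
Context (R : realType) (w : weights R) (hw : forall n, (1 <= n)%N -> 1 <= w n).

Lemma alpha_gt0 n : 0 < alpha w n.
Proof.
rewrite /alpha invr_gt0 big_seq_cond prodr_gt0// => i.
by rewrite andbT mem_index_iota => /andP[i1 _]; exact: wt_gt0.
Qed.

Lemma alphaS n : alpha w n = w n.+1 * alpha w n.+1.
Proof.
rewrite /alpha (big_nat_recr n.+1)//= invfM mulrCA mulfV ?mulr1//.
by rewrite gt_eqF// wt_gt0.
Qed.

Lemma alpha0 : alpha w 0 = 1.
Proof. by rewrite /alpha big_geq// invr1. Qed.

Lemma alpha_antitone m n : (m <= n)%N -> alpha w n <= alpha w m.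
Proof.
elim: n => [|n IH]; first by rewrite leqn0 => /eqP->.
rewrite leq_eqVlt => /predU1P[->//|mn]; apply: le_trans (IH mn).
by rewrite [leRHS]alphaS ler_peMl ?hw// ltW// alpha_gt0.
Qed.

Context (s : scalar_kind) (p : R) (p1 : 1 <= p).

Lemma iter_bshiftE (x : lp_space s p1) n i :
  iter n (bshift s p1 w) x i
  = of_real s (alpha w i / alpha w (n + i)) * x (n + i)%N.
Proof.
elim: n i => [|n IH] i.
  by rewrite add0n divff ?gt_eqF ?alpha_gt0//; case: (s) x => //= x; rewrite mul1r.
rewrite iterS -[LHS]/(of_real s (w i.+1) * iter n (bshift s p1 w) x i.+1).
by rewrite IH mulrA -of_realM addnS addSn mulrA -alphaS.
Qed.

End Weights.

Section PowerSums.
Context (R : realType) (s : scalar_kind) (p : R) (p1 : 1 <= p).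
Local Notation K := (Defs.scalar R s).
Local Notation lp := (lp_space s p1).

Let p0 : 0 < p. Proof. exact: lt_le_trans ltr01 p1. Qed.

Let powE0 (x : nat -> K) k : (0 <= (modulus (x k) `^ p)%:E)%E.
Proof. by rewrite lee_fin powR_ge0. Qed.

Lemma lp_enormX (x : nat -> K) :
  (lp_enorm p x `^ p = \sum_(0 <= k <oo) (modulus (x k) `^ p)%:E)%E.
Proof.
rewrite /lp_enorm (lnormE p1 (fun k => modulus (x k))) -poweRrM mulVf ?gt_eqF//.
rewrite poweRe1; last by apply: nneseries_ge0 => k _ _; rewrite lee_fin powR_ge0.
by under eq_eseriesr do rewrite ger0_norm ?modulus_ge0//.
Qed.

Lemma lp_seqP (x : nat -> K) :
  x \in lp_seq p <->
  exists B, forall N, \sum_(0 <= k < N) modulus (x k) `^ p <= B.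
Proof.
rewrite inE -(lty_nneseriesP 0 (f := fun k => modulus (x k) `^ p)); last first.
  by move=> k; exact: powR_ge0.
rewrite -lp_enormX; split=> [|xy]; first exact: poweR_lty.
by apply: (lty_poweRy _ xy); rewrite gt_eqF.
Qed.

Lemma lp_normX (x : lp) :
  ((lp_norm x `^ p)%:E = \sum_(0 <= k <oo) (modulus (x k) `^ p)%:E)%E.
Proof. by rewrite -lp_enormX -(lp_normE x) poweR_EFin. Qed.

Lemma psum_le_lp_norm (x : lp) N :
  \sum_(0 <= k < N) modulus (x k) `^ p <= lp_norm x `^ p.
Proof.
by rewrite -lee_fin lp_normX -sumEFin; exact: nneseries_lim_ge.
Qed.

Lemma modulus_le_lp_norm (x : lp) k : modulus (x k) <= lp_norm x.
Proof.
have : modulus (x k) `^ p <= lp_norm x `^ p.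
  apply: le_trans (psum_le_lp_norm x k.+1); rewrite big_nat_recr//= lerDr.
  by apply: sumr_ge0 => i _; exact: powR_ge0.
apply: contraTT; rewrite -!ltNge => h.
by rewrite gt0_ltr_powR ?nnegrE ?modulus_ge0 ?lp_norm_ge0.
Qed.

Lemma lp_norm_lt (x : lp) B e :
  (forall N, \sum_(0 <= k < N) modulus (x k) `^ p <= B) -> 0 < e ->
  B < e `^ p -> lp_norm x < e.
Proof.
move=> xB e0 Be; have : lp_norm x `^ p <= B.
  rewrite -lee_fin lp_normX; apply: lime_le; first exact: is_cvg_nneseries.
  by apply: nearW => N; rewrite sumEFin lee_fin.
apply: contraTT; rewrite -leNgt -ltNge => h; apply: (lt_le_trans Be).
by rewrite ge0_ler_powR ?nnegrE ?lp_norm_ge0 ?(ltW e0) ?(ltW p0).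
Qed.

Lemma powRD_le (a b : R) : 0 <= a -> 0 <= b ->
  (a + b) `^ p <= 2 `^ p * (a `^ p + b `^ p).
Proof.
have step (c d : R) : 0 <= c -> c <= d ->
    (c + d) `^ p <= 2 `^ p * (c `^ p + d `^ p).
  move=> c0 cd; have d0 := le_trans c0 cd.
  apply: (@le_trans _ _ ((2 * d) `^ p)).
    by rewrite ge0_ler_powR ?nnegrE ?mulr_ge0 ?addr_ge0 ?(ltW p0)//; lra.
  by rewrite powRM// ler_wpM2l ?powR_ge0// lerDr powR_ge0.
move=> a0 b0; case: (leP a b) => [|/ltW] ab; first exact: step.
by rewrite addrC [X in _ * X]addrC step.
Qed.

(** Balls of the space have radii in the scalar field; over the complex numbers a
    positive one is a real number, so real radii suffice. *)
Lemma open_lpP (U : set lp) (y : lp) : open U -> U y ->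
  exists e : R, 0 < e /\ forall x : lp, lp_norm (x - y) < e -> U x.
Proof.
rewrite openE => Uo /Uo /nbhs_ballP[e /= e0 eU].
have [e' e'0 e'e] : exists2 e' : R, 0 < e' & of_real s e' <= e.
  case: (s) e e0 {eU} => /= e e0; first by exists e.
  case: e e0 => a b; rewrite ltcE /= => /andP[/eqP -> a0].
  by exists a => //; rewrite /real_complex_def.
exists e'; split=> // x xy; apply: eU.
rewrite -ball_normE /ball_ /= distrC lp_normrE; apply: lt_le_trans e'e.
by rewrite lt_neqAle of_real_le (ltW xy) andbT (inj_eq of_real_inj) lt_eqF.
Qed.

Lemma modulusN (z : K) : modulus (- z) = modulus z.
Proof. by apply: (@of_real_inj R s); rewrite !modulusE normrN. Qed.

Lemma lp_seq_finite_support (x : nat -> K) L :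
  (forall k, (L <= k)%N -> x k = 0) -> x \in lp_seq p.
Proof.
move=> xL; apply/lp_seqP; exists (\sum_(0 <= k < L) modulus (x k) `^ p) => N.
apply: sum_le_support => k; first exact: powR_ge0.
by move=> Lk; rewrite xL// modulus0 powR0// gt_eqF.
Qed.

End PowerSums.

(** * Necessity of the summability condition *)

Section Necessity.
Context (R : realType) (rho : R -> R) (hrho : calibration rho).
Local Notation u := (calibration_seq rho).

(** The number of [j] with [u j <= N] is at most [rho N + 1], and [A] has at least
    [c * rho N] elements up to [N] for large [N]. So the indicator of [A] divided
    by [c], minus that of the range of [u], has partial sums bounded below, and
    summation by parts applies. *)
Lemma sum_calibration_seq_le (A : set nat) (g : nat -> R) (B : R) :
  (0 < lower_density rho A)%E -> ~ A 0%N ->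
  (forall n, 0 <= g n) -> (forall n, g n.+1 <= g n) ->
  (forall N, \sum_(0 <= n < N) \1_A n * g n <= B) ->
  exists B', forall M, \sum_(1 <= j < M) g (u j) <= B'.
Proof.
move=> /(lower_density_gt0P hrho)[c [c0 [N0 cN]]] A0 g0 gd gB.
(* Below [N0], where nothing is known of [A], at most [N0 + 1] values [u j] are
   counted. *)
pose C : R := N0.+1%:R.
exists (c^-1 * B + C * g 0%N) => -[|M].
  rewrite big_geq//; have := gB 0%N; rewrite big_geq// => B0.
  by rewrite addr_ge0// mulr_ge0 ?invr_ge0// ltW.
pose hits (n : nat) : R := \sum_(1 <= j < M.+1) (u j == n)%:R.
have hitsE N (h : nat -> R) :
    \sum_(0 <= n < N) hits n * h n
    = \sum_(1 <= j < M.+1) (u j < N)%N%:R * h (u j).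
  under eq_bigr do rewrite mulr_suml.
  rewrite exchange_big/=; apply: eq_bigr => j _.
  have [ujN|Nuj] := ltnP (u j) N; first by rewrite sum_indicator_eq// mul1r.
  rewrite mul0r big_nat_cond big1// => n; rewrite andbT => nN.
  by rewrite (_ : (u j == n) = false) ?mul0r//; lia.
have AE N : \sum_(0 <= n < N.+1) (\1_A n : R) = \sum_(1 <= n < N.+1) \1_A n.
  by rewrite big_ltn// indicE memNset// add0r.
have dC N : - C <= \sum_(0 <= n < N) (c^-1 * \1_A n - hits n).
  case: N => [|N]; first by rewrite big_geq// oppr_le0 ler0n.
  rewrite sumrB -mulr_sumr AE.
  have -> : \sum_(0 <= n < N.+1) hits n = \sum_(1 <= j < M.+1) (u j < N.+1)%N%:R.
    transitivity (\sum_(0 <= n < N.+1) hits n * 1).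
      by apply: eq_bigr => n _; rewrite mulr1.
    by rewrite (hitsE N.+1 (fun=> 1)); apply: eq_bigr => j _; rewrite mulr1.
  have rN : 0 <= rho N%:R by rewrite (calibration_ge0 hrho).
  have hr : \sum_(1 <= j < M.+1) (u j < N.+1)%N%:R <= rho N%:R + 1.
    apply: le_trans (sum_indic_le M (addr_ge0 rN ler01)).
    apply: ler_sum => j _; rewrite ler_nat ltnS.
    case: (leqP (u j) N) => // ujN.
    by rewrite (le_calibration_seq hrho ujN).
  have A_ge0 : 0 <= c^-1 * \sum_(1 <= n < N.+1) (\1_A n : R).
    rewrite mulr_ge0 ?invr_ge0 ?(ltW c0)//; apply: sumr_ge0 => n _.
    by rewrite indicE ler0n.
  have [NN0|N0N] := leqP N0 N.
  - have : rho N%:R <= c^-1 * \sum_(1 <= n < N.+1) (\1_A n : R).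
      by rewrite ler_pdivlMl// cN.
    have : 1 <= C by rewrite /C ler1n.
    by lra.
  - have : rho N%:R + 1 <= C.
      rewrite /C -natr1 lerD2r (le_trans (calibration_le_id hrho _))//.
      by rewrite ler_nat ltnW.
    by lra.
have := summation_by_parts_ge g0 gd dC (u M).+1.
under eq_bigr do rewrite mulrBl -mulrA.
rewrite sumrB -mulr_sumr hitsE => h.
have -> : \sum_(1 <= j < M.+1) g (u j)
    = \sum_(1 <= j < M.+1) (u j < (u M).+1)%N%:R * g (u j).
  rewrite big_nat_cond [RHS]big_nat_cond; apply: eq_bigr => j.
  by rewrite andbT ltnS => /andP[_ jM]; rewrite ltnS calibration_seq_mono ?mul1r.
have : c^-1 * \sum_(0 <= n < (u M).+1) \1_A n * g n <= c^-1 * B.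
  by rewrite ler_wpM2l ?invr_ge0 ?(ltW c0).
by move: h; lra.
Qed.

Context (s : scalar_kind) (p : R) (p1 : 1 <= p).
Context (w : weights R) (hw : forall n : nat, (1 <= n)%N -> 1 <= w n).

(** If [B^n x] is within 1/2 of the first basis vector, its first coordinate
    [x n / alpha n] has modulus at least 1/2, so [alpha n <= 2 |x n|]. *)
Lemma frequently_hypercyclic_summable :
  frequently_hypercyclic rho (bshift s p1 w) ->
  exists B, forall M, \sum_(1 <= j < M) alpha w (u j) `^ p <= B.
Proof.
have p0 : 0 < p := lt_le_trans ltr01 p1.
case=> _ [x xU].
pose e0 : lp_space s p1 := Lp p1 (lp_seq_finite_support p1
  (x := fun k => of_real s (k == 0%N)%:R) (L := 1%N) (fun k k1 =>
  etrans (congr1 (fun b : bool => of_real s (b%:R : R)) (gtn_eqF k1)) of_real0)).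
pose U : set (lp_space s p1) := ball e0 (of_real s 2^-1).
have Ue0 : U e0.
  apply: ballxx.
  by rewrite -of_real0 lt_neqAle of_real_le (inj_eq of_real_inj); lra.
have UP y : U y -> 1 <= 2 * modulus (y 0%N).
  rewrite /U -ball_normE /ball_ /= lp_normrE => /ltW; rewrite of_real_le => yU.
  have := le_trans (modulus_le_lp_norm (e0 - y) 0) yU.
  rewrite -[(e0 - y) 0%N]/(of_real s 1 - y 0%N) => h.
  have := modulusD (of_real s 1 - y 0%N) (y 0%N).
  by rewrite subrK modulus_of_real normr1; lra.
have A0 := xU U (ball_open _ _) (ex_intro _ e0 Ue0).
apply: (sum_calibration_seq_le (g := fun n => alpha w n `^ p)
  (B := 2 `^ p * lp_norm x `^ p) A0) => [[]//|n|n|N].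
- exact: powR_ge0.
- by rewrite ge0_ler_powR ?nnegrE ?alpha_antitone// ltW// ?alpha_gt0.
apply: le_trans (ler_wpM2l (powR_ge0 _ _) (psum_le_lp_norm x N)).
rewrite mulr_sumr; apply: ler_sum => n _; rewrite indicE.
have [|_] := boolP (n \in _); last by rewrite mul0r mulr_ge0 ?powR_ge0.
rewrite inE mul1r => -[n0 /UP].
rewrite iter_bshiftE// modulusM modulus_of_real alpha0 addn0 mul1r => h.
have an := alpha_gt0 w n.
rewrite -powRM ?modulus_ge0// ge0_ler_powR ?nnegrE ?(ltW p0) ?(ltW an)//.
  by rewrite mulr_ge0 ?modulus_ge0.
have an1 : 0 <= (alpha w n)^-1 by rewrite invr_ge0 ltW.
by move: h; rewrite (ger0_norm an1) mulrCA ler_pdivlMl// mulr1.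
Qed.

End Necessity.

(** * Visiting times *)

Lemma lognX_odd a b : logn 2 (2 ^ a * b.*2.+1) = a.
Proof.
rewrite lognM ?expn_gt0// pfactorK// logn_coprime ?addn0//.
by rewrite coprime2n /= odd_double.
Qed.

(** Going from [j] to [j + 1] increases it by [1 + nu j + nu (j + 1)], with [nu]
    the 2-adic valuation: [j] occupies a block reaching [nu j] to either side. *)
Definition position (j : nat) : nat := j + logn 2 j`! + logn 2 (j.-1)`!.

Lemma logn2_fact_le n : (logn 2 n`! <= n)%N.
Proof.
rewrite logn_fact//.
suff H m : (\sum_(1 <= k < m.+1) n %/ 2 ^ k + n %/ 2 ^ m <= n)%N.
  exact: leq_trans (leq_addr _ _) (H n).
elim: m => [|m IH]; first by rewrite big_geq// add0n expn0 divn1.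
apply: leq_trans IH; rewrite big_nat_recr//= -addnA leq_add2l.
by rewrite expnSr divnMA; set q := (n %/ 2 ^ m)%N; lia.
Qed.

Lemma position_le j : (position j <= 3 * j)%N.
Proof.
rewrite /position; have := logn2_fact_le j; have := logn2_fact_le j.-1.
by case: j => //= j; lia.
Qed.

Lemma position_gap j k : (j < k)%N ->
  (position j + (logn 2 j + logn 2 k).+1 <= position k)%N.
Proof.
have factS n : logn 2 n.+1`! = (logn 2 n.+1 + logn 2 n`!)%N.
  by rewrite factS lognM// fact_gt0.
have mono m n : (m <= n)%N -> (logn 2 m`! <= logn 2 n`!)%N.
  elim: n => [|n IH]; first by rewrite leqn0 => /eqP->.
  rewrite leq_eqVlt => /predU1P[->//|/IH mn].
  by rewrite factS (leq_trans mn)// leq_addl.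
rewrite /position; case: k => // k; rewrite ltnS factS/=.
case: j => [_|j jk] /=; first by rewrite logn0 fact0 logn1; lia.
by have := mono _ _ jk; rewrite !factS; lia.
Qed.


Section VisitTimes.
Context (R : realType) (rho : R -> R) (hrho : calibration rho).
Local Notation u := (calibration_seq rho).

Definition time (j : nat) : nat := u (position j).

(** Superadditivity of [u], with [k <= u k], carries the gaps over from
    [position]. *)
Lemma time_gap j k : (j < k)%N ->
  (time j + (logn 2 j + logn 2 k).+1 <= time k)%N.
Proof.
move=> jk; have jk' := position_gap jk.
have := calibration_seq_sub hrho (leq_trans (leq_addr _ _) jk').
have := calibration_seq_ge hrho (position k - position j).
have := calibration_seq_mono hrho (leq_trans (leq_addr _ _) jk').
by rewrite /time; lia.
Qed.

Lemma time_lt j k : (j < k)%N -> (time j < time k)%N.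
Proof. by move=> /time_gap; lia. Qed.

Lemma time_ge j : (j <= time j)%N.
Proof. by elim: j => // j IH; apply: leq_ltn_trans IH (time_lt (ltnSn j)). Qed.

Lemma time0 : time 0 = 0%N.
Proof. by rewrite /time /position /= fact0 logn1 calibration_seq0. Qed.

End VisitTimes.


(** * Finitely supported rational vectors *)

Section RationalTargets.
Context (R : realType) (s : scalar_kind) (p : R) (p1 : 1 <= p).
Local Notation K := (Defs.scalar R s).

Let p0 : 0 < p. Proof. exact: lt_le_trans ltr01 p1. Qed.

Definition rational_scalar (q : rat * rat) : K :=
  match s with
  | RealScalars => ratr q.1 : R
  | ComplexScalars => Complex (ratr q.1 : R) (ratr q.2)
  end.

Lemma rational_scalar0 : rational_scalar (0, 0) = 0.
Proof. by rewrite /rational_scalar; case: (s); rewrite /= !rmorph0. Qed.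

Lemma rational_scalar_dense (z : K) (e : R) : 0 < e ->
  exists q, modulus (z - rational_scalar q) < e.
Proof.
have near (a d : R) : 0 < d -> exists q : rat, `|a - ratr q| < d.
  move=> d0; have [|q] := @rat_in_itvoo R (a - d) (a + d); first by lra.
  by rewrite in_itv/= => /andP[? ?]; exists q; rewrite ltr_norml; lra.
rewrite /rational_scalar; case: (s) z => /= z e0.
  by have [q] := near z e e0; exists (q, 0).
case: z => a b.
have e20 : 0 < e / 2 by rewrite divr_gt0.
have [q1 a1] := near a _ e20; have [q2 b2] := near b _ e20.
exists (q1, q2); rewrite /= -[ltRHS](ger0_norm (ltW e0)) -sqrtr_sqr.
rewrite ltr_sqrt ?exprn_gt0//.
have sq (t : R) : `|t| < e / 2 -> t ^+ 2 < (e / 2) ^+ 2.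
  move=> te; rewrite -real_normK ?num_real// ltr_pXn2r// nnegrE//.
  exact: ltW.
by have := sq _ a1; have := sq _ b2; have := sqr_ge0 e; nra.
Qed.

Definition rational_seq (t : seq (rat * rat)) (k : nat) : K :=
  rational_scalar (nth (0, 0) t k).

Lemma rational_seq_default t k : (size t <= k)%N -> rational_seq t k = 0.
Proof. by move=> tk; rewrite /rational_seq nth_default// rational_scalar0. Qed.

Lemma rational_seq_dense (y : lp_space s p1) (d : R) : 0 < d ->
  exists t, forall N,
    \sum_(0 <= k < N) modulus (y k - rational_seq t k) `^ p <= d.
Proof.
move=> d0; have d20 : 0 < d / 2 by rewrite divr_gt0.
(* Half of the error is for the tail beyond [L], half for the first [L]
   coordinates. *)
have y0 k : 0 <= modulus (y k) `^ p by exact: powR_ge0.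
have [L yL] := summable_tail y0 (psum_le_lp_norm y) d20.
pose eta := d / 2 / L.+1%:R; have eta0 : 0 < eta by rewrite divr_gt0.
have [q yq] := choice (fun k =>
  rational_scalar_dense (y k) (powR_gt0 p^-1 eta0)).
exists (mkseq q L) => N.
pose h k := modulus (y k - rational_seq (mkseq q L) k) `^ p.
have h0 k : 0 <= h k by exact: powR_ge0.
apply: (@le_trans _ _ (\sum_(0 <= k < L + N) h k)).
  by rewrite [leRHS](big_cat_nat (leq0n N) (leq_addl L N))/= lerDl sumr_ge0.
rewrite (big_cat_nat (leq0n L) (leq_addr N L))/=.
rewrite [leRHS](splitr d); apply: lerD.
  apply: (@le_trans _ _ (\sum_(0 <= k < L) eta)).
    rewrite big_nat_cond [leRHS]big_nat_cond; apply: ler_sum => k.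
    rewrite andbT => /andP[_ kL]; rewrite /h /rational_seq nth_mkseq//.
    have := ltW (yq k) => /(ge0_ler_powR (ltW p0)).
    rewrite !nnegrE modulus_ge0 powR_ge0 => /(_ isT isT).
    by rewrite -powRrM mulVf ?gt_eqF// powRr1// ltW.
  rewrite big_const_nat iter_addr_0 subn0 -[leLHS]mulr_natr /eta.
  by rewrite mulrAC ler_pdivrMr// ler_pM2l// ler_nat.
apply: le_trans (yL (L + N)%N).
rewrite big_nat_cond [leRHS]big_nat_cond; apply: ler_sum => k.
rewrite andbT => /andP[Lk _]; rewrite /h rational_seq_default ?subr0//.
by rewrite size_mkseq.
Qed.

Lemma modulus_sum_disjoint (F : nat -> K) (m n : nat) :
  (forall k l, (k < l)%N -> F k != 0 -> F l = 0) ->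
  modulus (\sum_(m <= k < n) F k) `^ p
  <= \sum_(m <= k < n) modulus (F k) `^ p.
Proof.
have z0 : modulus (0 : K) `^ p = 0 by rewrite modulus0 powR0// gt_eqF.
move=> Fdisj; elim: n => [|n IH]; first by rewrite !big_geq// z0.
have [nm|mn] := ltnP n m; first by rewrite !big_geq// z0.
rewrite !big_nat_recr//=; have [->|Fn] := eqVneq (F n) 0.
  by rewrite addr0 z0 addr0.
rewrite big_nat_cond big1 ?add0r; last first.
  move=> k; rewrite andbT => /andP[_ kn]; apply/eqP/negPn/negP => Fk.
  by rewrite (Fdisj _ _ kn Fk) eqxx in Fn.
by rewrite lerDr sumr_ge0// => k _; exact: powR_ge0.
Qed.

End RationalTargets.

(** * Sufficiency of the summability condition *)

Section Construction.
Context (R : realType) (rho : R -> R) (hrho : calibration rho).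
Context (s : scalar_kind) (p : R) (p1 : 1 <= p).
Context (w : weights R) (hw : forall n : nat, (1 <= n)%N -> 1 <= w n).
Local Notation K := (Defs.scalar R s).
Local Notation u := (calibration_seq rho).
Local Notation a i := (alpha w (u i) `^ p).

Let p0 : 0 < p. Proof. exact: lt_le_trans ltr01 p1. Qed.
Let alpha_pos := alpha_gt0 w.

(** The p-th power of the norm of the vector translated by [n] is at most
    [alpha w n `^ p] times this, because [alpha w (n + k) <= alpha w n]. *)
Definition lift_cost (t : seq (rat * rat)) : R :=
  \sum_(0 <= k < size t) (modulus (rational_seq R s t k) / alpha w k) `^ p.

Context (c : nat -> R).
Context (c_gt0 : forall n, 0 < c n).
Context (c_mono : forall m n, (m <= n)%N -> c m <= c n).
Context (c_unbounded : forall M, exists n, M <= c n).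
Context (c_tail : forall r N, \sum_(r <= n < N) c n * a n <= 2 / c r).

(** Every vector is the decoding of [logn 2 r] for arbitrarily large [r]; it is
    replaced by the zero vector as long as [r] is too small for its length and
    cost, a restriction that ends because [c] is unbounded. *)
Definition target (r : nat) : seq (rat * rat) :=
  let t := odflt [::] (unpickle (logn 2 r)) in
  if (size t <= r)%N && (lift_cost t <= c r) then t else [::].

Lemma size_target r : (size (target r) <= r)%N.
Proof. by rewrite /target; case: ifP => // /andP[]. Qed.

Lemma lift_cost_target r : lift_cost (target r) <= c r.
Proof.
rewrite /target; case: ifP => [/andP[]//|_].
by rewrite /lift_cost big_geq// ltW.
Qed.

Lemma target_recurs t (M : R) : exists r, target r = t /\ M <= c r.
Proof.
have [m cm] := c_unbounded (Num.max M (lift_cost t)).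
pose b := maxn m (size t); exists (2 ^ pickle t * b.*2.+1)%N.
have br : (b <= 2 ^ pickle t * b.*2.+1)%N.
  have : (0 < 2 ^ pickle t)%N by rewrite expn_gt0.
  by set q := (2 ^ _)%N; nia.
have := le_trans cm (c_mono (leq_trans (leq_maxl m (size t)) br)).
rewrite ge_max => /andP[Mc tc]; split => //.
by rewrite /target lognX_odd pickleK/= tc (leq_trans (leq_maxr m (size t)) br).
Qed.

Local Notation y j := (rational_seq R s (target (logn 2 j))).

(** Coordinate [i], after [n] steps of the shift, of the translate to [time k] of
    the vector of index [k]. It is meant for [n <= time k]. *)
Definition block (k n i : nat) : K :=
  if (time rho k <= n + i)%N then
    of_real s (alpha w i / alpha w (n + i - time rho k))
      * y k (n + i - time rho k)%N
  else 0.

Lemma block_support k n i : block k n i != 0 ->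
  (time rho k <= n + i < time rho k + logn 2 k)%N.
Proof.
rewrite /block; case: ifP => [tk|]; last by rewrite eqxx.
apply: contraR; rewrite /= -leqNgt => h.
rewrite rational_seq_default ?mulr0//.
by apply: leq_trans (size_target _) _; lia.
Qed.

(** The translate of index [k] ends before [time k + logn 2 k], and the gap to the
    next visiting time is longer. *)
Lemma block_disjoint n i k l : (k < l)%N -> block k n i != 0 -> block l n i = 0.
Proof.
move=> kl /block_support/andP[_ h]; apply/eqP/negPn/negP => /block_support.
by move=> /andP[h' _]; have := time_gap hrho kl; lia.
Qed.

(** What the translates of index [k > j] contribute at [time j]. The upper bound
    loses nothing as [k <= time k]. For [j = 0], where [time 0 = 0], this is the
    whole vector, so that one estimate gives both its membership in the space
    and the accuracy of the visits. *)
Definition remainder (j i : nat) : K :=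
  \sum_(j.+1 <= k < (time rho j + i).+1) block k (time rho j) i.

Lemma remainder_widen j i L : (time rho j + i < L)%N ->
  remainder j i = \sum_(j.+1 <= k < L) block k (time rho j) i.
Proof.
move=> iL; have jt : (j.+1 <= (time rho j + i).+1)%N by have := time_ge hrho j; lia.
rewrite (big_cat_nat jt iL)/= [X in _ + X]big_nat_cond [X in _ + X]big1 ?addr0//.
move=> k; rewrite andbT => /andP[tk _]; rewrite /block ifF//.
by have := time_ge hrho k; lia.
Qed.

(** With [d = time k - time j], the translate costs [alpha w d `^ p] times at most
    [c (logn 2 k)]; both factors are compared at [position k - position j], which
    is at least [logn 2 k] and has image under [u] at most [d]. *)
Lemma block_sum j k N : (j < k)%N ->
  \sum_(0 <= i < N) modulus (block k (time rho j) i) `^ p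
  <= c (position k - position j) * a (position k - position j)%N.
Proof.
move=> jk; set d := (time rho k - time rho j)%N; have tjk := time_gap hrho jk.
pose h m := (modulus (y k m) / alpha w m) `^ p.
have h0 m : 0 <= h m by exact: powR_ge0.
have hC M : \sum_(0 <= m < M) h m <= lift_cost (target (logn 2 k)).
  apply: sum_le_support => // m sm.
  by rewrite /h rational_seq_default// modulus0 mul0r powR0// gt_eqF.
apply: (@le_trans _ _ (alpha w d `^ p * lift_cost (target (logn 2 k)))).
  apply: le_trans (ler_wpM2l (powR_ge0 _ _) (hC (N - d)%N)).
  have [Nd|/ltnW dN] := leqP N d.
    rewrite big_nat_cond big1 ?mulr_ge0 ?powR_ge0 ?sumr_ge0// => i.
    rewrite andbT => /andP[_ iN]; rewrite /block ifF ?modulus0 ?powR0 ?gt_eqF//.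
    by rewrite /d in Nd; lia.
  rewrite (big_cat_nat (leq0n d) dN)/= big_nat_cond big1 ?add0r; last first.
    move=> i; rewrite andbT => /andP[_ id].
    rewrite /block ifF ?modulus0 ?powR0 ?gt_eqF//.
    by rewrite /d in id; lia.
  rewrite -{1}[d]add0n big_addn mulr_sumr; apply: ler_sum => m _.
  rewrite /block ifT; last by rewrite /d; lia.
  rewrite (_ : (time rho j + (m + d) - time rho k)%N = m); last by rewrite /d; lia.
  rewrite modulusM modulus_of_real ger0_norm ?divr_ge0 ?(ltW (alpha_pos _))//.
  have alpha_ge0 n : 0 <= alpha w n := ltW (alpha_pos n).
  have ym0 : 0 <= modulus (y k m) / alpha w m by rewrite divr_ge0 ?modulus_ge0.
  rewrite mulrAC -mulrA /h -powRM// ge0_ler_powR ?nnegrE ?(ltW p0)//.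
  - exact: mulr_ge0.
  - exact: mulr_ge0.
  rewrite ler_wpM2r//.
  by rewrite alpha_antitone// leq_addl.
have jk' := position_gap jk.
rewrite mulrC; apply: ler_pM; rewrite ?powR_ge0//.
- by apply: sumr_ge0 => m _; exact: powR_ge0.
- by apply: le_trans (lift_cost_target _) (c_mono _); lia.
- rewrite ge0_ler_powR ?nnegrE ?(ltW p0) ?(ltW (alpha_pos _))//.
  rewrite alpha_antitone// /d /time calibration_seq_sub//; lia.
Qed.

(** The blocks being disjoint, the p-th powers of their norms add up; the
    differences [position k - position j] are distinct and exceed [logn 2 j], so
    the total is at most a tail of the series of [c i * a i]. *)
Lemma remainder_sum j N :
  \sum_(0 <= i < N) modulus (remainder j i) `^ p <= 2 / c (logn 2 j).
Proof.
pose L := (time rho j + N).+1.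
apply: (@le_trans _ _ (\sum_(0 <= i < N) \sum_(j.+1 <= k < L)
    modulus (block k (time rho j) i) `^ p)).
  rewrite big_nat_cond [leRHS]big_nat_cond; apply: ler_sum => i.
  rewrite andbT => /andP[_ iN]; rewrite (@remainder_widen _ _ L); last first.
    by rewrite /L; lia.
  by apply: modulus_sum_disjoint => // k l; exact: block_disjoint.
rewrite exchange_big/=.
apply: le_trans (c_tail _ (position L - position j)).
apply: le_trans; last first.
  apply: (@sum_increasing_le _ (fun i => c i * a i) position) => [i|k l kl|k jk].
  - by rewrite mulr_ge0 ?powR_ge0 ?ltW.
  - by have := position_gap kl; lia.
  - by have := position_gap jk; lia.
rewrite big_nat_cond [leRHS]big_nat_cond; apply: ler_sum => k.
by rewrite andbT => /andP[jk _]; exact: block_sum.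
Qed.

Lemma remainder0_lp : remainder 0 \in lp_seq p.
Proof. by apply/(lp_seqP p1); eexists => N; exact: remainder_sum. Qed.

Definition hypercyclic_vector : lp_space s p1 := Lp p1 remainder0_lp.

(** Blocks of index below [j] end before [time j], and block [j] starts there. *)
Lemma orbitE j i : (0 < j)%N ->
  iter (time rho j) (bshift s p1 w) hypercyclic_vector i = y j i + remainder j i.
Proof.
move=> j0; rewrite iter_bshiftE// -[hypercyclic_vector _]/(remainder 0 _).
set m := (time rho j + i)%N.
have jm : (j <= m.+1)%N by have := time_ge hrho j; rewrite /m; lia.
have jm' : (j.+1 <= m.+1)%N by have := time_ge hrho j; rewrite /m; lia.
have blockE k : of_real s (alpha w i / alpha w m) * block k (time rho 0) m
    = block k (time rho j) i.
  rewrite /block (time0 hrho) add0n -/m; case: ifP => _; last by rewrite mulr0.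
  rewrite mulrA -of_realM mulrA divfK// gt_eqF//.
have -> : remainder 0 m = \sum_(1 <= k < m.+1) block k (time rho 0) m.
  by rewrite /remainder {1}(time0 hrho) add0n.
rewrite mulr_sumr /remainder.
under eq_bigr do rewrite blockE.
rewrite (big_cat_nat j0 jm)/= big_nat_cond big1 ?add0r; last first.
  move=> k; rewrite andbT => /andP[_ kj]; apply/eqP/negPn/negP => /block_support.
  by have := time_gap hrho kj; lia.
rewrite big_ltn//; congr (_ + _).
rewrite /block leq_addr addKn divff ?gt_eqF//.
by case: (s) (y j i) => //= z; rewrite mul1r.
Qed.

Lemma hypercyclic_vector_visits (U : set (lp_space s p1)) :
  open U -> U !=set0 ->
  exists r, forall j, (0 < j)%N -> logn 2 j = r ->
    return_set (bshift s p1 w) hypercyclic_vector U (time rho j).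
Proof.
move=> Uo [x0 Ux0]; have [e [e0 eU]] := open_lpP Uo Ux0.
have e2 : 0 < 2 `^ p :> R by rewrite powR_gt0.
have ep : 0 < e `^ p by rewrite powR_gt0.
(* The errors of the rational approximation and of the remainder are at most [d]
   each, and the p-th power of a sum costs a factor [2 `^ p]. *)
pose d := e `^ p / (4 * 2 `^ p); have d0 : 0 < d by rewrite divr_gt0// mulr_gt0.
have [t td] := rational_seq_dense x0 d0.
have [r [rt rc]] := target_recurs t (2 / d); exists r => j j0 jr.
split; first exact: leq_trans j0 (time_ge hrho j).
apply: eU; apply: (@lp_norm_lt _ _ _ _ _ (2 `^ p * (d + d))) => // [N|]; last first.
  have -> : 2 `^ p * (d + d) = e `^ p / 2 by rewrite /d; field; rewrite gt_eqF.
  by lra.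
apply: (@le_trans _ _ (2 `^ p *
  (\sum_(0 <= k < N) modulus (x0 k - rational_seq R s t k) `^ p
   + \sum_(0 <= k < N) modulus (remainder j k) `^ p))); last first.
  rewrite ler_wpM2l ?(ltW e2)//; apply: lerD => //.
  apply: le_trans (remainder_sum _ _) _; rewrite jr.
  by rewrite ler_pdivrMr// mulrC -ler_pdivrMr.
rewrite -big_split/= mulr_sumr; apply: ler_sum => k _.
rewrite -[X in modulus X `^ p <= _]/(
  iter (time rho j) (bshift s p1 w) hypercyclic_vector k - x0 k).
rewrite orbitE// jr rt.
apply: le_trans (powRD_le p1 (modulus_ge0 _) (modulus_ge0 _)).
rewrite ge0_ler_powR ?nnegrE ?(ltW p0) ?addr_ge0 ?modulus_ge0//.
rewrite -(modulusN (x0 k - _)) opprB addrAC.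
exact: modulusD.
Qed.

End Construction.

(** [f i <= N] as soon as [D * (i + 1) <= rho N], so [A] has at least the integer
    part of [rho N / D] elements up to [N]. *)
Lemma lower_density_subsequence_gt0 (R : realType) (rho : R -> R)
    (hrho : calibration rho) (A : set nat) (f : nat -> nat) (D : nat) :
  (0 < D)%N -> (forall i, A (f i)) -> (forall i, (0 < f i)%N) ->
  (forall i j, (i < j)%N -> (f i < f j)%N) ->
  (forall i, (f i <= calibration_seq rho (D * i.+1))%N) ->
  (0 < lower_density rho A)%E.
Proof.
move=> D0 fA f0 finc fle; apply/(lower_density_gt0P hrho).
have DR : 0 < D%:R :> R by rewrite ltr0n.
have A_ge0 n : 0 <= \1_A n :> R by rewrite indicE ler0n.
exists (2 * D%:R)^-1; split; first by rewrite invr_gt0 mulr_gt0.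
have [N0 rhoN] := calibration_cvgy hrho (2 * D%:R); exists N0 => N /rhoN rN.
have rN0 : 0 <= rho N%:R / D%:R.
  by rewrite divr_ge0 ?(calibration_ge0 hrho)// ltW.
pose k := Num.truncn (rho N%:R / D%:R).
have /andP[kle ltk] := truncn_itv rN0.
have fA1 i : \1_A (f i) = 1 :> R by rewrite indicE mem_set.
have sum_mono M M' : (M <= M')%N ->
    \sum_(1 <= n < M.+1) \1_A n <= \sum_(1 <= n < M'.+1) (\1_A n : R).
  move=> MM'; rewrite [leRHS](big_cat_nat (ltn0Sn M) (MM' : (M.+1 <= M'.+1)%N))/=.
  by rewrite lerDl sumr_ge0.
have count m : m.+1%:R <= \sum_(1 <= n < (f m).+1) (\1_A n : R).
  elim: m => [|m IH]; rewrite big_nat_recr//= fA1; first by rewrite lerDr sumr_ge0.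
  rewrite -natr1 lerD2r (le_trans IH)//.
  have := finc _ _ (ltnSn m); case: (f m.+1) => // M fM.
  exact: sum_mono.
have k2 : 2 <= rho N%:R / D%:R by rewrite ler_pdivlMr.
have k0 : (0 < k)%N by rewrite truncn_gt0 (le_trans _ k2)// ler1n.
have fkN : (f k.-1 <= N)%N.
  apply: leq_trans (fle _) _; rewrite prednK//.
  apply: (calibration_seq_le hrho).
  by rewrite natrM mulrC -ler_pdivlMr.
apply: le_trans (le_trans (count k.-1) (sum_mono _ _ fkN)).
rewrite prednK// invfM mulrAC -mulrA [X in _ * X]mulrC.
by move: ltk; rewrite -natr1 -/k; lra.
Qed.

Lemma summable_frequently_hypercyclic (R : realType) (rho : R -> R)
    (hrho : calibration rho) (s : scalar_kind) (p : R) (p1 : 1 <= p)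
    (w : weights R) (hw : forall n : nat, (1 <= n)%N -> 1 <= w n) :
  (exists B : R, forall M,
    \sum_(1 <= j < M) alpha w (calibration_seq rho j) `^ p <= B) ->
  frequently_hypercyclic rho (bshift s p1 w).
Proof.
move=> [B aB]; pose a j := alpha w (calibration_seq rho j) `^ p.
have a0 j : 0 < a j by rewrite powR_gt0// alpha_gt0.
have aB0 N : \sum_(0 <= j < N) a j <= a 0%N + Num.max B 0.
  case: N => [|N].
    by rewrite big_geq// addr_ge0 ?(ltW (a0 _))// le_max lexx orbT.
  by rewrite big_ltn// lerD2l (le_trans (aB _))// le_max lexx.
have [c [c_gt0 c_mono c_unbounded c_tail]] := summable_amplification a0 aB0.
split; first exact: bshift_continuous.
exists (hypercyclic_vector hrho s p1 hw c_gt0 c_mono c_tail) => U Uo U0.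
have [r rU] :=
  hypercyclic_vector_visits hrho hw c_gt0 c_mono c_unbounded c_tail Uo U0.
pose j i := (2 ^ r * i.*2.+1)%N.
have q0 : (0 < 2 ^ r)%N by rewrite expn_gt0.
have j0 i : (0 < j i)%N by rewrite muln_gt0 q0.
apply: (lower_density_subsequence_gt0 hrho (f := fun i => time rho (j i))
  (D := 3 * 2 ^ r.+1)).
(* The [i]-th index of class [r] is [2 ^ r * (2 * i + 1) <= 2 ^ r.+1 * (i + 1)], and
   [position] grows at most by a factor 3. *)
- by rewrite muln_gt0 expn_gt0.
- by move=> i; apply: rU => //; exact: lognX_odd.
- by move=> i; apply: leq_trans (j0 i) (time_ge hrho (j i)).
- by move=> i k ik; apply: time_lt => //; rewrite ltn_pmul2l//; lia.
- move=> i; apply: calibration_seq_mono => //.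
  apply: leq_trans (position_le _) _; rewrite -mulnA leq_mul2l/=.
  by rewrite /j expnS mulnAC -mulnA; set q := (2 ^ r)%N; nia.
Qed.

(** * The characterization *)

Theorem theorem4p2 (R : realType) (rho : R -> R) (hrho : calibration rho)
    (s : scalar_kind) (p : R) (p1 : 1 <= p)
    (w : weights R) (hw : forall n : nat, (1 <= n)%N -> 1 <= w n) :
  frequently_hypercyclic rho (bshift s p1 w) <->
  (\sum_(1 <= j <oo) (alpha w (calibration_seq rho j) `^ p)%:E < +oo)%E.
Proof.
rewrite (lty_nneseriesP 1 (f := fun j => alpha w (calibration_seq rho j) `^ p)).
  split; first exact: frequently_hypercyclic_summable.
  exact: summable_frequently_hypercyclic.
by move=> j; exact: powR_ge0.
Qed.
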